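(* Let $E/\mathbf{k}$ be a finite Galois extension of fields with Galois group $G$, let $V_0$ be a finite dimensional $\mathbf{k}$-vector space, and set $V=V_0\otimes_{\mathbf{k}}E$, with the natural action of $G$ on $V$. (i) Suppose $A\subset V$ is an $E$-linear subspace such that for some integer $r\ge 0$ one has $\dim_E(A/(A\cap\sigma A))\le r$ for each $\sigma\in G$. Then there exists a $\mathbf{k}$-linear subspace $W_0\subset V_0$ such that for $W=W_0\otimes_{\mathbf{k}}E\subset V$ one has $$\dim_E(W/(W\cap A))\le r,\qquad \dim_E(A/(W\cap A))\le r\cdot(r+1)^{r+1}.$$ (ii) Suppose $V_0'$ is another finite dimensional $\mathbf{k}$-vector space, $V'=V_0'\otimes_{\mathbf{k}}E$, and $T:V\to V'$ is an $E$-linear operator such that for some integer $r\ge 0$ one has $\operatorname{rk}_E(\sigma(T)-T)\le r$ for every $\sigma\in G$. Then there exists a $\mathbf{k}$-linear operator $T_0:V_0\to V_0'$ such that $$\operatorname{rk}_E(T-(T_0)_E)\le 2r+r\cdot(r+1)^{r+1},$$ where $(T_0)_E:V\to V'$ is the $E$-linear operator obtained from $T_0$ by extension of scalars.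
   Context: The natural action of $\sigma\in G$ on $V=V_0\otimes_{\mathbf{k}}E$ is $\sigma(v\otimes e)=v\otimes\sigma(e)$ (a $\sigma$-semilinear action), and similarly on $V'$. It induces an action on $E$-linear subspaces, $A\mapsto\sigma A=\{\sigma(a): a\in A\}$, and on $E$-linear operators $T:V\to V'$, $\sigma(T)=\sigma\circ T\circ\sigma^{-1}$ (again $E$-linear). $\operatorname{rk}_E$ denotes the dimension over $E$ of the image. *)

(* Defs.v *)
From HB Require Import structures.
From mathcomp Require Import all_boot all_order all_algebra.
From mathcomp Require Import all_fingroup all_solvable all_field.

Set Implicit Arguments.
Unset Strict Implicit.
Unset Printing Implicit Defensive.

Import GRing.Theory.
Local Open Scope ring_scope.

(* The tensor product V0 ⊗_k E, as the E-vector space of coordinate vectors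
   over E in a fixed basis of V0: the coordinates of v ⊗ e are those of v
   multiplied by e.
   [tensor_universal] is the universal property of the tensor product. *)
Definition tensor (k : fieldType) (E : fieldExtType k) (V0 : vectType k) : Type :=
  'rV[E]_(\dim {:V0}).

Section Tensor.

Variables (k : fieldType) (E : fieldExtType k) (V0 : vectType k).

Definition pure_tensor (v : V0) (e : E) : tensor E V0 :=
  \row_i (coord (vbasis {:V0}) i v *: e).

Lemma pure_tensorE v e i : pure_tensor v e 0 i = coord (vbasis {:V0}) i v *: e.
Proof. exact: mxE. Qed.

Lemma pure_tensorDl u v e :
  pure_tensor (u + v) e = pure_tensor u e + pure_tensor v e.
Proof. by apply/rowP=> i; rewrite !mxE linearD scalerDl. Qed.

Lemma pure_tensorDr v e f :
  pure_tensor v (e + f) = pure_tensor v e + pure_tensor v f.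
Proof. by apply/rowP=> i; rewrite !mxE scalerDr. Qed.

Lemma pure_tensor0l e : pure_tensor 0 e = 0.
Proof. by apply/rowP=> i; rewrite !mxE linear0 scale0r. Qed.

Lemma pure_tensorZl a v e : pure_tensor (a *: v) e = pure_tensor v (a *: e).
Proof. by apply/rowP=> i; rewrite !mxE linearZ /= scalerA mulrC. Qed.

Lemma pure_tensorZr v c e : pure_tensor v (c * e) = c *: pure_tensor v e.
Proof. by apply/rowP=> i; rewrite !mxE scalerAr. Qed.

Lemma tensor_decomp (u : tensor E V0) :
  u = \sum_(i < \dim {:V0}) pure_tensor (vbasis {:V0})`_i ((u : 'rV_(\dim {:V0})) 0 i).
Proof.
apply/rowP=> j; rewrite summxE (bigD1 j) //= big1 => [|i /negPf ij].
  by rewrite pure_tensorE coord_free ?(basis_free (vbasisP _)) // eqxx scale1r addr0.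
by rewrite pure_tensorE coord_free ?(basis_free (vbasisP _)) // ij scale0r.
Qed.

Lemma vec_decomp (v : V0) :
  v = \sum_(i < \dim {:V0}) coord (vbasis {:V0}) i v *: (vbasis {:V0})`_i.
Proof. exact: coord_vbasis (memvf v). Qed.

(* Every k-bilinear map on V0 × E factors uniquely through pure_tensor. *)
Lemma tensor_universal (U : lmodType k) (f : V0 -> E -> U) :
  (forall e, linear (f^~ e)) -> (forall v, linear (f v)) ->
  exists g : tensor E V0 -> U,
    [/\ forall u w, g (u + w) = g u + g w,
        forall a u, g (a%:A *: u) = a *: g u,
        forall v e, g (pure_tensor v e) = f v e
      & forall h : tensor E V0 -> U, (forall u w, h (u + w) = h u + h w) ->
          (forall v e, h (pure_tensor v e) = f v e) -> h =1 g].
Proof.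
move=> fl fr.
have fDl e u v : f (u + v) e = f u e + f v e.
  by have := fl e 1 u v; rewrite !scale1r.
have f0l e : f 0 e = 0 by apply: (addrI (f 0 e)); rewrite -fDl !addr0.
have fZl e a v : f (a *: v) e = a *: f v e.
  by have := fl e a v 0; rewrite addr0 f0l addr0.
have fDr e e' v : f v (e + e') = f v e + f v e'.
  by have := fr v 1 e e'; rewrite !scale1r.
have f0r v : f v 0 = 0 by apply: (addrI (f v 0)); rewrite -fDr !addr0.
have fZr e a v : f v (a *: e) = a *: f v e.
  by have := fr v a e 0; rewrite addr0 f0r addr0.
exists (fun u => \sum_(i < \dim {:V0}) f (vbasis {:V0})`_i ((u : 'rV_(\dim {:V0})) 0 i)); split.
- move=> u w; rewrite -big_split; apply: eq_bigr => i _ /=.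
  by rewrite mxE fDr.
- move=> a u; rewrite scaler_sumr; apply: eq_bigr => i _.
  by rewrite mxE mulr_algl fZr.
- move=> v e; rewrite [in RHS](vec_decomp v).
  rewrite (big_morph (f^~ e) (fDl e) (f0l e)); apply: eq_bigr => i _.
  by rewrite pure_tensorE fZr fZl.
- move=> h hD hf u; rewrite {1}(tensor_decomp u).
  have h0 : h 0 = 0 by apply: (addrI (h 0)); rewrite -hD !addr0.
  by rewrite (big_morph h hD h0); apply: eq_bigr => i _.
Qed.

(* W0 ⊗_k E as a subspace of V0 ⊗_k E. *)
Definition extend_vs (W0 : {vspace V0}) : {vspace tensor E V0} :=
  <<[seq pure_tensor w 1 | w <- vbasis W0]>>%VS.

(* It is the E-span of the pure tensors on vectors of W0. *)
Lemma extend_vs_subP (W0 : {vspace V0}) (U : {vspace tensor E V0}) :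
  reflect (forall w e, w \in W0 -> pure_tensor w e \in U) (extend_vs W0 <= U)%VS.
Proof.
apply: (iffP span_subvP) => [sU w e | sU _ /mapP[w /vbasis_mem Ww ->]].
  move=> /coord_vbasis->.
  rewrite (big_morph (pure_tensor^~ e) (id1 := 0) (op1 := +%R)); first last.
  - exact: pure_tensor0l.
  - by move=> u v; exact: pure_tensorDl.
  apply: memv_suml => i _; rewrite pure_tensorZl -[_ *: e]mulr1 pure_tensorZr.
  by apply/memvZ/sU/map_f/mem_nth; rewrite size_tuple.
exact: sU.
Qed.

End Tensor.

Section ExtendHom.

Variables (k : fieldType) (E : fieldExtType k) (V0 V0' : vectType k).

(* (T0)_E = T0 ⊗ id_E *)
Definition extend_hom (T0 : 'Hom(V0, V0')) : 'Hom(tensor E V0, tensor E V0') :=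
  linfun (fun u : tensor E V0 =>
    \sum_(i < \dim {:V0}) pure_tensor (T0 (vbasis {:V0})`_i) ((u : 'rV_(\dim {:V0})) 0 i)).

Lemma extend_homE (T0 : 'Hom(V0, V0')) v e :
  extend_hom T0 (pure_tensor v e) = pure_tensor (T0 v) e.
Proof.
pose F (u : tensor E V0) : tensor E V0' :=
  \sum_(i < \dim {:V0}) pure_tensor (T0 (vbasis {:V0})`_i) ((u : 'rV_(\dim {:V0})) 0 i).
have Flin : linear F.
  move=> c u w; rewrite /F scaler_sumr -big_split; apply: eq_bigr => i _ /=.
  by rewrite !mxE pure_tensorDr pure_tensorZr.
pose Fl := GRing.isLinear.Build _ _ _ _ F Flin.
pose FL : {linear tensor E V0 -> tensor E V0'} := HB.pack F Fl.
rewrite [LHS](lfunE FL) /= /F [in RHS](vec_decomp v) linear_sum.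
rewrite (big_morph (@pure_tensor k E V0' ^~ e) (id1 := 0) (op1 := +%R)); first last.
- exact: pure_tensor0l.
- by move=> x y; exact: pure_tensorDl.
by apply: eq_bigr => i _; rewrite pure_tensorE linearZ pure_tensorZl.
Qed.

End ExtendHom.

Section GaloisAction.

Variables (k : fieldType) (E : splittingFieldType k) (V0 : vectType k).
Implicit Types s : gal_of {:E}.

Definition gal_act s (u : tensor E V0) : tensor E V0 := map_mx s u.

Lemma gal_act_pure s (v : V0) (e : E) :
  gal_act s (pure_tensor v e) = pure_tensor v (s e).
Proof.
apply/rowP=> i; have := pure_tensorE v (s e) i => ->.
by rewrite mxE pure_tensorE linearZ.
Qed.

Lemma gal_actD s (u w : tensor E V0) :
  gal_act s (u + w) = gal_act s u + gal_act s w.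
Proof. exact: map_mxD. Qed.

Lemma gal_actZ s c (u : tensor E V0) :
  gal_act s (c *: u) = s c *: gal_act s u.
Proof. exact: map_mxZ. Qed.

Lemma gal_actK s : cancel (gal_act s) (gal_act s^-1%g).
Proof.
by move=> u; apply/rowP=> i; rewrite !mxE -galM ?memvf // mulgV gal_id.
Qed.

Lemma gal_actVK s : cancel (gal_act s^-1%g) (gal_act s).
Proof. by move=> u; rewrite -{1}[s]invgK gal_actK. Qed.

(* The set {s(a) : a in A}, as a subspace; see [mem_gal_vs]. *)
Definition gal_vs s (A : {vspace tensor E V0}) : {vspace tensor E V0} :=
  <<[seq gal_act s a | a <- vbasis A]>>%VS.

Lemma mem_gal_vs s (A : {vspace tensor E V0}) u :
  u \in gal_vs s A <-> exists2 a, a \in A & u = gal_act s a.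
Proof.
have act0 s' : gal_act s' (0 : tensor E V0) = 0 by exact: map_mx0.
have actsum s' := big_morph _ (gal_actD s') (act0 s').
set X := [seq gal_act s a | a <- vbasis A].
split=> [uX | [a Aa ->]].
  exists (gal_act s^-1%g u); last by rewrite gal_actVK.
  have -> : u = \sum_i coord (in_tuple X) i u *: X`_i.
    exact: coord_span (in_tuple X) u uX.
  rewrite actsum; apply: memv_suml => i _; rewrite gal_actZ memvZ //=.
  have /mapP[a Aa ->] : X`_i \in X by rewrite mem_nth.
  by rewrite gal_actK vbasis_mem.
rewrite (coord_vbasis Aa) actsum; apply: memv_suml => i _.
rewrite gal_actZ memvZ //.
by apply/memv_span/map_f/mem_nth; rewrite size_tuple.
Qed.

End GaloisAction.

Section GaloisActionHom.

Variables (k : fieldType) (E : splittingFieldType k) (V0 V0' : vectType k).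
Implicit Types s : gal_of {:E}.

(* s o T o s^-1 *)
Definition gal_hom s (T : 'Hom(tensor E V0, tensor E V0')) :
    'Hom(tensor E V0, tensor E V0') :=
  linfun (fun u => gal_act s (T (gal_act s^-1%g u))).

Lemma gal_homE s (T : 'Hom(tensor E V0, tensor E V0')) u :
  gal_hom s T u = gal_act s (T (gal_act s^-1%g u)).
Proof.
pose F (u : tensor E V0) : tensor E V0' := gal_act s (T (gal_act s^-1%g u)).
have Flin : linear F.
  move=> c x y; rewrite /F gal_actD gal_actZ linearP gal_actD gal_actZ.
  by rewrite -galM ?memvf // mulVg gal_id.
pose Fl := GRing.isLinear.Build _ _ _ _ F Flin.
pose FL : {linear tensor E V0 -> tensor E V0'} := HB.pack F Fl.
exact: (lfunE FL).
Qed.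

End GaloisActionHom.

(* dim (A / B), intended for B <= A: A :\: B is then a complement of B in A. *)
Definition dim_quot (K : fieldType) (V : vectType K) (A B : {vspace V}) : nat :=
  \dim (A :\: B).

(* It is the dimension of the image of A under any linear map whose restriction
   to A has kernel B. *)
Lemma dim_quotE (K : fieldType) (V U : vectType K) (A B : {vspace V})
    (f : 'Hom(V, U)) :
  (B <= A)%VS -> (A :&: lker f = B)%VS -> dim_quot A B = \dim (f @: A).
Proof.
move=> /capv_idPr sBA kerB; apply: (@addnI (\dim B)).
by rewrite /dim_quot -{1}sBA dimv_cap_compl -{1}kerB limg_ker_dim.
Qed.

Definition rk (K : fieldType) (V V' : vectType K) (T : 'Hom(V, V')) : nat :=
  \dim (limg T).

(* Main.v *)
Require Import Defs.
From HB Require Import structures.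
From mathcomp Require Import all_boot all_order all_algebra.
From mathcomp Require Import all_fingroup all_solvable all_field.
From mathcomp Require Import zify.

(* Let B <= A be such that every B + gA exceeds A by at most d dimensions
   (d = r for B = A), and let W be the sum of the translates gB.  If W exceeds
   A by at most r dimensions, then W is the invariant subspace sought, as it
   contains B.  Otherwise r + 1 translates of B already exceed A by more than r
   dimensions; let B' be the intersection of B with them.  If B' + gA exceeded
   A by d dimensions for some g, it would contain each of these translates,
   which would therefore lie in A + gA, a contradiction.  Hence d drops by one
   while the codimension c of B in A grows to at most (r + 2) c + r (r + 1); for
   d = 0 the sum W lies in A.  Starting from A this gives codimension at most
   r (r + 2)^r <= r (r + 1)^(r + 1).  Galois descent turns W into W0 ⊗ E.

   For an operator T, apply this to the graph of T in V ⊕ V': the W0 obtained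
   is, up to its small intersection with V0', the graph of a k-linear map
   defined on its projection to V0. *)

Set Implicit Arguments.
Unset Strict Implicit.
Unset Printing Implicit Defensive.

Import GRing.Theory.
Local Open Scope ring_scope.

(** * Almost invariant subspaces under a group action *)

Lemma sumv_finite_subfamily (K : fieldType) (U : vectType K) (I : finType)
    (A : {vspace U}) (F : I -> {vspace U}) (n : nat) :
  (\dim A + n <= \dim (A + \sum_i F i)%VS)%N ->
  exists s : seq I,
    (size s <= n)%N /\ (\dim A + n <= \dim (A + \sum_(i <- s) F i)%VS)%N.
Proof.
elim: n => [|n IHn] hn.
  by exists [::]; rewrite addn0 big_nil addv0.
have [|s [sn hs]] := IHn; first by lia.
have [hs1|hs1] := leqP (\dim A + n.+1) (\dim (A + \sum_(i <- s) F i)%VS).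
  by exists s; split=> //; lia.
(* Greedy choice: either the current sum contains every [F i] and so has the full dimension, or some
   [F i] raises its dimension by at least one. *)
have [/forallP Fs|/forallPn[i Fi]] :=
    boolP [forall i, (F i <= A + \sum_(j <- s) F j)%VS].
  have : (A + \sum_i F i <= A + \sum_(j <- s) F j)%VS.
    by rewrite subv_add addvSl; apply/subv_sumP=> i _; exact: Fs.
  by move/dimvS; lia.
exists (i :: s); split=> //; rewrite big_cons addvA [(A + F i)%VS]addvC -addvA.
set X := (A + _)%VS in hs Fi *.
suff : (\dim X < \dim (F i + X)%VS)%N by lia.
rewrite ltn_neqAle dimvS ?addvSr // andbT; apply: contra Fi => /eqP Xd.
have /eqP-> : X == (F i + X)%VS by rewrite eqEdim addvSr Xd /=.
exact: addvSl.
Qed.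

Section AlmostInvariant.

Variables (K : fieldType) (U : vectType K) (gT : finGroupType).
(** Only the action on subspaces is abstracted, because Galois automorphisms act semilinearly rather
    than by elements of ['End(U)]. Products compose from left to right, as for [gal_of]. *)
Variable act : gT -> {vspace U} -> {vspace U}.
Hypothesis act1 : forall X, act 1%g X = X.
Hypothesis actM : forall g h X, act h (act g X) = act (g * h)%g X.
Hypothesis actS : forall g X Y, (X <= Y)%VS -> (act g X <= act g Y)%VS.
Hypothesis dim_act : forall g X, \dim (act g X) = \dim X.

Lemma act_adj g X Y : (act g X <= Y)%VS = (X <= act g^-1%g Y)%VS.
Proof.
apply/idP/idP=> [/(actS g^-1%g)|/(actS g)]; first by rewrite actM mulgV act1.
by rewrite actM mulVg act1.
Qed.

Variables (A : {vspace U}) (r : nat).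
Hypothesis Ar : forall g, (\dim (A + act g A)%VS <= \dim A + r)%N.

(** Intersecting [Y <= A] with one more [gB] loses at most [c + r] dimensions: [Y + gB] lies in
    [A + gA], of dimension at most [\dim A + r], while [\dim gB >= \dim A - c]. *)
Lemma dim_cap_translates (B X : {vspace U}) (c : nat) (s : seq gT) :
    (B <= A)%VS -> (\dim A <= \dim B + c)%N -> (X <= A)%VS ->
  (\dim X <= \dim (X :&: \bigcap_(g <- s) act g B)%VS + size s * (c + r))%N.
Proof.
move=> BA Bc XA; elim: s => [|g s IHs]; first by rewrite big_nil capvf; lia.
rewrite big_cons capvA [(X :&: act g B)%VS]capvC -capvA /=; set Y := (X :&: _)%VS in IHs *.
have YA : (Y <= A)%VS by rewrite (subv_trans (capvSl _ _)).
have := dimvS (addvS YA (actS g BA)); have := Ar g.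
have := dimv_sum_cap Y (act g B); rewrite capvC dim_act /=; lia.
Qed.

(** Replacing [c] by [c + (r + 1)(c + r)] multiplies [c + r] by exactly [r + 2]; hence the bound is
    stated for [c + r]. *)
Lemma almost_invariant_step (d c : nat) (B : {vspace U}) :
    (B <= A)%VS -> (\dim A <= \dim B + c)%N ->
    (forall g, (\dim (B + act g A)%VS <= \dim A + d)%N) ->
  exists W : {vspace U}, [/\ forall g, (act g W <= W)%VS,
    (\dim W <= \dim (W :&: A)%VS + r)%N &
    (\dim A + r <= \dim (W :&: A)%VS + r.+2 ^ d * (c + r))%N].
Proof.
elim: d c B => [|d IHd] c B BA Bc Bd.
all: pose W := (\sum_g act g B)%VS.
all: have BW : (B <= W)%VS by rewrite -[B]act1 (sumv_sup 1%g).
all: have Winv h : (act h W <= W)%VS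
  by rewrite act_adj; apply/subv_sumP=> g _; rewrite -act_adj actM;
     exact: (sumv_sup (g * h)%g).
all: have cap_ge : (\dim B <= \dim (W :&: A)%VS)%N
  by apply: dimvS; rewrite subv_cap BW.
all: have := dimv_sum_cap W A => dimWA.
  have WA : (W <= A)%VS.
    apply/subv_sumP=> g _; rewrite act_adj.
    (* With [d = 0] the sum is no larger than the translate of [A] inside it. *)
    have /eqP-> : act g^-1%g A == (B + act g^-1%g A)%VS.
      by rewrite eqEdim addvSr dim_act -[\dim A]addn0 Bd.
    exact: addvSl.
  exists W; split=> //; first by rewrite (capv_idPl WA); lia.
  by rewrite expn0; lia.
have [WAr|WAr] := leqP (\dim (W + A)%VS) (\dim A + r).
  have := expn_gt0 r.+2 d.+1 => /= e_gt0.
  by exists W; split=> //; nia.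
have [|s [s_r dim_s]] := @sumv_finite_subfamily _ _ _ A (act^~ B) r.+1.
  by rewrite addvC addnS.
pose B' := (B :&: \bigcap_(g <- s) act g B)%VS.
have B'B : (B' <= B)%VS by exact: capvSl.
have B'A : (B' <= A)%VS by exact: subv_trans BA.
have B'd g : (\dim (B' + act g A)%VS <= \dim A + d)%N.
  rewrite leqNgt; apply/negP=> B'g.
  have sB' h : h \in s -> (act h B <= B' + act g A)%VS.
    move=> hs; have B'h : (B' <= act h B)%VS.
      rewrite (subv_trans (capvSr _ _)) //.
      by rewrite (big_rem h) //= capvSl.
    (* The right side contains the left and lies in [h(B + g h^-1 A)], of dimension at most
       [\dim A + d + 1]; by [B'g] the left side already has that dimension. *)
    have /eqP-> : (B' + act g A == act h B + act g A)%VS.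
      rewrite eqEdim addvS //= (leq_trans _ B'g) //.
      have hBA : (act h B + act g A <= act h (B + act (g * h^-1) A))%VS.
        rewrite subv_add actS ?addvSl //=.
        by rewrite -{1}(mulgKV h g) -(actM (g * h^-1)%g) actS ?addvSr.
      have := Bd (g * h^-1)%g; rewrite -(dim_act h).
      by move/(leq_trans (dimvS hBA)); lia.
    exact: addvSl.
  have : (A + \sum_(h <- s) act h B <= A + act g A)%VS.
    rewrite subv_add addvSl big_seq.
    apply: (big_ind (fun X => X <= A + act g A)%VS) => [|X Y XS YS|h /sB'].
    - exact: sub0v.
    - by rewrite subv_add XS.
    - by move/subv_trans; apply; rewrite addvS.
  by move/dimvS; have := Ar g; lia.
have [|W' [W'inv W'1 W'2]] := IHd (c + r.+1 * (c + r))%N B' B'A _ B'd.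
  have := dim_cap_translates s BA Bc BA; rewrite -/B'.
  have : (size s * (c + r) <= r.+1 * (c + r))%N by rewrite leq_mul2r s_r orbT.
  move=> le_s dimB; rewrite (leq_trans Bc) // addnCA addnC leq_add2l.
  by rewrite (leq_trans dimB) // leq_add2l.
exists W'; split=> //; rewrite (leq_trans W'2) // leq_add2l expnSr -mulnA.
by rewrite leq_mul2l; apply/orP; right; lia.
Qed.

Lemma almost_invariant :
  exists W : {vspace U}, [/\ forall g, (act g W <= W)%VS,
    (\dim W <= \dim (W :&: A)%VS + r)%N &
    (\dim A <= \dim (W :&: A)%VS + r * (r + 1) ^ (r + 1))%N].
Proof.
have [|||W [Winv W1 W2]] := @almost_invariant_step r 0 A => //; first lia.
exists W; split=> //.
suff : (r.+2 ^ r <= (r + 1) ^ (r + 1))%N by nia.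
rewrite addn1 expnS.
(* Used at [k = r]. The induction step reduces to [(k + 1)(r + 2) <= (k + 2)(r + 1)], that is, to
   [k <= r]. *)
have: forall k, (k <= r.+1 -> r.+2 ^ k <= k.+1 * r.+1 ^ k)%N.
  by elim=> // k IHk kr; have := IHk (ltnW kr); rewrite !expnS; nia.
by apply; exact: leqnSn.
Qed.

End AlmostInvariant.

(** * Galois descent for subspaces *)

Section ExtendVs.

Variables (k : fieldType) (E : fieldExtType k) (V0 : vectType k).

Lemma pure_tensor_suml (I : Type) (r : seq I) (F : I -> V0) (e : E) :
  pure_tensor (\sum_(i <- r) F i) e = \sum_(i <- r) pure_tensor (F i) e.
Proof.
elim/big_rec2: _ => [|i _ v _ <-]; first exact: pure_tensor0l.
exact: pure_tensorDl.
Qed.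

Lemma pure_tensorE1 (v : V0) (e : E) : pure_tensor v e = e *: pure_tensor v 1.
Proof. by rewrite -pure_tensorZr mulr1. Qed.

Lemma mem_extend_vs (W0 : {vspace V0}) (w : V0) (e : E) :
  w \in W0 -> pure_tensor w e \in extend_vs E W0.
Proof. by move: w e; apply/extend_vs_subP. Qed.

Lemma extend_vs_span_sub (X : seq V0) (U : {vspace tensor E V0}) :
  {in X, forall x, pure_tensor x 1 \in U} -> (extend_vs E <<X>> <= U)%VS.
Proof.
move=> XU; apply/extend_vs_subP=> v e /(coord_span (X := in_tuple X)) ->.
rewrite pure_tensor_suml; apply: memv_suml => i _.
by rewrite pure_tensorZl pure_tensorE1 memvZ ?XU ?mem_nth.
Qed.

End ExtendVs.

Section GaloisDescent.

Variables (k : fieldType) (E : splittingFieldType k) (V0 : vectType k).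
Implicit Types (s t : gal_of {:E}) (A B : {vspace tensor E V0}).

Lemma mem_gal_act s A u : u \in A -> gal_act s u \in gal_vs s A.
Proof. by move=> Au; apply/mem_gal_vs; exists u. Qed.

Lemma gal_actM s t (u : tensor E V0) :
  gal_act t (gal_act s u) = gal_act (s * t)%g u.
Proof. by apply/rowP=> i; rewrite !mxE galM ?memvf. Qed.

Lemma gal_act1 (u : tensor E V0) : gal_act 1%g u = u.
Proof. by apply/rowP=> i; rewrite mxE gal_id. Qed.

Lemma gal_vs1 A : gal_vs 1%g A = A.
Proof.
apply/vspaceP=> u; apply/idP/idP=> [/mem_gal_vs[a Aa ->]|Au].
  by rewrite gal_act1.
by rewrite -[u]gal_act1 mem_gal_act.
Qed.

Lemma gal_vsS s A B : (A <= B)%VS -> (gal_vs s A <= gal_vs s B)%VS.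
Proof.
move/subvP=> AB; apply/subvP=> _ /mem_gal_vs[a Aa ->].
exact/mem_gal_act/AB.
Qed.

Lemma gal_vsM s t A : gal_vs t (gal_vs s A) = gal_vs (s * t)%g A.
Proof.
apply/vspaceP=> u; apply/idP/idP.
  by move=> /mem_gal_vs[_ /mem_gal_vs[a Aa ->] ->]; rewrite gal_actM mem_gal_act.
by move=> /mem_gal_vs[a Aa ->]; rewrite -gal_actM !mem_gal_act.
Qed.

Lemma dim_gal_vs s A : \dim (gal_vs s A) = \dim A.
Proof.
have le t B : (\dim (gal_vs t B) <= \dim B)%N.
  by rewrite (leq_trans (dim_span _)) // size_map size_tuple.
by apply/eqP; rewrite eqn_leq le -{1}(gal_vs1 A) -(mulgV s) -gal_vsM le.
Qed.

Lemma gal_act_sum s (I : Type) (r : seq I) (F : I -> tensor E V0) :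
  gal_act s (\sum_(i <- r) F i) = \sum_(i <- r) gal_act s (F i).
Proof. elim/big_rec2: _ => [|i _ v _ <-]; first exact: map_mx0.
exact: gal_actD. Qed.

Hypothesis galE : galois 1%VS {:E}%VS.

(** Each coordinate is fixed by the Galois group, hence lies in [k]. *)
Lemma gal_fixed_pure (u : tensor E V0) :
  (forall s, gal_act s u = u) -> exists v, u = pure_tensor v 1.
Proof.
move=> fix_u.
have ui i : exists c : k, (u : 'rV_(\dim {:V0})) 0 i == c%:A.
  have : (u : 'rV_(\dim {:V0})) 0 i \in fixedField 'Gal({:E} / 1)%g.
    apply/fixedFieldP=> [|s _]; first exact: memvf.
    by rewrite -{2}(fix_u s) mxE.
  by rewrite (galois_fixedField galE) => /vlineP[c ->]; exists c.
exists (\sum_i xchoose (ui i) *: (vbasis {:V0})`_i).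
apply/rowP=> i; rewrite mxE coord_sum_free ?(basis_free (vbasisP _)) //.
exact/eqP/(xchooseP (ui i)).
Qed.

(* By independence of the automorphisms, W is spanned over E by the traces of
   its E-multiples, and traces are Galois-invariant. *)
Lemma galois_descent (W : {vspace tensor E V0}) :
  (forall s, (gal_vs s W <= W)%VS) -> exists W0 : {vspace V0}, extend_vs E W0 = W.
Proof.
move=> Winv.
have actW s u : u \in W -> gal_act s u \in W.
  by move=> Wu; apply/(subvP (Winv s))/mem_gal_act.
pose tr (e : E) (w : tensor E V0) := \sum_s gal_act s (e *: w).
have trW e w : w \in W -> tr e w \in W.
  by move=> Ww; apply: memv_suml => s _; rewrite actW ?memvZ.
have tr_pure e w : exists v, tr e w == pure_tensor v 1.
  have [|v] := @gal_fixed_pure (tr e w); last by move=> ->; exists v.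
  move=> t; rewrite gal_act_sum [RHS](reindex_inj (mulIg t)) /=.
  by apply: eq_bigr => s _; rewrite gal_actM.
pose f e w := xchoose (tr_pure e w).
have fE e w : pure_tensor (f e w) 1 = tr e w by rewrite -(eqP (xchooseP (tr_pure e w))).
pose W0 := <<[seq f e w | e <- vbasis {:E}, w <- vbasis W]>>%VS.
exists W0; apply/eqP; rewrite eqEsubv; apply/andP; split.
  apply: extend_vs_span_sub => _ /allpairsP[[e w] [_ Ww ->]] /=.
  by rewrite fE trW ?vbasis_mem.
rewrite -(span_basis (vbasisP W)); apply/span_subvP=> w Ww.
have tr_basis e : e \in vbasis {:E} -> tr e w \in extend_vs E W0.
  by move=> Ee; rewrite -fE mem_extend_vs // memv_span // allpairs_f.
have tr_all e : tr e w \in extend_vs E W0.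
  have trD e1 e2 : tr (e1 + e2) w = tr e1 w + tr e2 w.
    by rewrite -big_split; apply: eq_bigr => s _ /=; rewrite scalerDl gal_actD.
  have tr0 : tr 0 w = 0 by apply: (addrI (tr 0 w)); rewrite -trD !addr0.
  rewrite (coord_vbasis (memvf e)) (big_morph (tr^~ w) trD tr0).
  apply: memv_suml => i _; set c := coord _ _ _.
  suff -> : tr (c *: (vbasis {:E})`_i) w = c%:A *: tr (vbasis {:E})`_i w.
    by rewrite memvZ // tr_basis // mem_nth ?size_tuple.
  rewrite scaler_sumr; apply: eq_bigr => s _.
  have sc : s c%:A = c%:A by rewrite linearZ /= rmorph1.
  by rewrite -[c *: _]mulr_algl -scalerA gal_actZ sc.
(* [p] is [E]-linear with kernel [extend_vs E W0], so it kills every trace: the sum of the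
   [s(a) p(s w)] vanishes for all [a]. Independence of the automorphisms, applied to each
   coordinate, gives [p(s w) = 0]; take [s = 1]. *)
pose p : 'End(tensor E V0) := \1%VF - projv (extend_vs E W0).
have ker_p u : (p u == 0) = (u \in extend_vs E W0).
  rewrite add_lfunE opp_lfunE id_lfunE subr_eq0; apply/eqP/idP=> [->|/projv_id->] //.
  exact: memv_proj.
rewrite -ker_p; apply/eqP/rowP=> i; rewrite [RHS]mxE.
have c0 : forall s, true -> (p (gal_act s w) : 'rV_(\dim {:V0})) 0 i = 0.
  apply: gal_independent => a _.
  have /eqP : p (tr a w) == 0 by rewrite ker_p tr_all.
  rewrite linear_sum => /(congr1 (fun u : 'rV_(\dim {:V0}) => u 0 i)).
  rewrite summxE [RHS]mxE; apply: etrans.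
  by apply: eq_bigr => s _; rewrite gal_actZ linearZ mxE mulrC.
by rewrite -[w]gal_act1 c0.
Qed.

End GaloisDescent.

(** * Almost Galois-invariant subspaces *)

Lemma dim_quot_cap (K : fieldType) (V : vectType K) (A B : {vspace V}) :
  (B <= A)%VS -> (\dim B + dim_quot A B)%N = \dim A.
Proof. by move=> /capv_idPr {1}<-; exact: dimv_cap_compl. Qed.

Lemma in_gal1 (k : fieldType) (E : splittingFieldType k) (s : gal_of {:E}) :
  s \in 'Gal({:E} / 1)%g.
Proof. by rewrite gal_kHom ?sub1v // k1HomE ahomWin. Qed.

(** Since [sA] and [A] have equal dimension, the codimension of their intersection in [A] is the
    excess of [A + sA] over [A]. *)
Lemma almost_invariant_descent (k : fieldType) (E : splittingFieldType k)
    (galE : galois 1%VS {:E}%VS) (V0 : vectType k)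
    (A : {vspace tensor E V0}) (r : nat) :
    (forall s : gal_of {:E}, (dim_quot A (A :&: gal_vs s A)%VS <= r)%N) ->
  exists W0 : {vspace V0},
    (dim_quot (extend_vs E W0) (extend_vs E W0 :&: A)%VS <= r)%N /\
    (dim_quot A (extend_vs E W0 :&: A)%VS <= r * (r + 1) ^ (r + 1))%N.
Proof.
move=> Ar.
have [||||g|W [Winv W1 W2]] := @almost_invariant _ _ _
  (@gal_vs _ E V0) _ _ _ _ A r.
- exact: gal_vs1.
- exact: gal_vsM.
- exact: gal_vsS.
- exact: dim_gal_vs.
- have := dim_quot_cap (capvSl A (gal_vs g A)); have := Ar g.
  have := dimv_sum_cap A (gal_vs g A); rewrite dim_gal_vs; lia.
have [W0 W0W] := galois_descent galE Winv.
exists W0; rewrite W0W.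
have := dim_quot_cap (capvSl W A); have := dim_quot_cap (capvSr W A).
by split; lia.
Qed.

(** * Functoriality of extension of scalars *)

Section ExtendHom.

Variables (k : fieldType) (E : splittingFieldType k).
Implicit Types (U V W : vectType k).

(** The tensors [v ⊗ 1] span over [E]; identities between extended maps are checked on them. *)
Lemma tensor_lfunP V (X : vectType E) (f g : 'Hom(tensor E V, X)) :
  (forall v, f (pure_tensor v 1) = g (pure_tensor v 1)) -> f = g.
Proof.
move=> fg; apply/lfunP=> u; rewrite (tensor_decomp u) !linear_sum.
by apply: eq_bigr => i _; rewrite pure_tensorE1 !linearZ /= fg.
Qed.

Lemma gal_act_extend_hom V W (f : 'Hom(V, W)) (s : gal_of {:E}) u :
  gal_act s (extend_hom E f u) = extend_hom E f (gal_act s u).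
Proof.
rewrite (tensor_decomp u) !(linear_sum, gal_act_sum); apply: eq_bigr => i _.
by rewrite /= gal_act_pure !extend_homE gal_act_pure.
Qed.

Lemma eq_in_extend_hom V W (f g : 'Hom(V, W)) (X : {vspace V}) :
  {in X, f =1 g} -> {in extend_vs E X, extend_hom E f =1 extend_hom E g}.
Proof.
move=> fg; apply/eqlfun_inP/extend_vs_subP=> v e Xv.
by apply/eqlfunP; rewrite !extend_homE fg.
Qed.

Lemma eq_extend_hom V W (f g : 'Hom(V, W)) :
  f =1 g -> extend_hom E f = extend_hom E g.
Proof. by move=> /lfunP->. Qed.

Lemma extend_hom1 V u : extend_hom E (\1%VF : 'End(V)) u = u.
Proof.
rewrite -[RHS](id_lfunE u); congr (fun_of_lfun _ u); apply: tensor_lfunP => v.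
by rewrite extend_homE !id_lfunE.
Qed.

Lemma extend_hom0 V W u : extend_hom E (0 : 'Hom(V, W)) u = 0.
Proof.
rewrite -[RHS](zero_lfunE _ u); congr (fun_of_lfun _ u).
apply: tensor_lfunP => v.
by rewrite extend_homE !zero_lfunE pure_tensor0l.
Qed.

Lemma extend_hom_comp U V W (g : 'Hom(V, W)) (f : 'Hom(U, V)) u :
  extend_hom E (g \o f)%VF u = extend_hom E g (extend_hom E f u).
Proof.
rewrite -comp_lfunE; congr (fun_of_lfun _ u); apply: tensor_lfunP => v.
by rewrite comp_lfunE !extend_homE comp_lfunE.
Qed.

End ExtendHom.

Lemma linfunE (K : fieldType) (V W : vectType K) (f : V -> W) :
  linear f -> linfun f =1 f.
Proof.
move=> flin; pose fl := GRing.isLinear.Build _ _ _ _ f flin.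
pose fL : {linear V -> W} := HB.pack f fl.
exact: (lfunE fL).
Qed.

(** * Direct sums and graphs of operators *)

Section PairHom.

Variables (k : fieldType) (V W : vectType k).

(** Coordinates on [tensor E (V * W)] refer to an arbitrary basis of [V * W], so its two summands
    are accessed only through the extensions of these four maps. *)
Definition fst_hom : 'Hom((V * W)%type, V) := linfun fst.
Definition snd_hom : 'Hom((V * W)%type, W) := linfun snd.
Definition inl_hom : 'Hom(V, (V * W)%type) := linfun (fun v => (v, 0)).
Definition inr_hom : 'Hom(W, (V * W)%type) := linfun (fun w => (0, w)).

Lemma fst_homE x : fst_hom x = x.1. Proof. exact: lfunE. Qed.
Lemma snd_homE x : snd_hom x = x.2. Proof. exact: lfunE. Qed.

Lemma inl_homE v : inl_hom v = (v, 0).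
Proof. by apply: linfunE => a x y; congr pair; rewrite /= scaler0 addr0. Qed.

Lemma inr_homE w : inr_hom w = (0, w).
Proof. by apply: linfunE => a x y; congr pair; rewrite /= scaler0 addr0. Qed.

End PairHom.

(** On [X], the preimage of [Y] under [j], the rank of [h] is at most [\dim Z], which is at most [r]
    because [Z] meets [limg j] trivially inside [Y]. As [X] has codimension at most [n], the rest of
    the space adds at most [n]. *)
Lemma rk_le_graph_close (K : fieldType) (V V' U : vectType K)
    (h : 'Hom(V, V')) (j : 'Hom(V, U)) (q : 'Hom(U, V')) (Y Z : {vspace U})
    (r n : nat) :
    lker j == 0%VS -> (Z <= Y)%VS -> (Z :&: limg j = 0)%VS ->
    (forall u, j u \in Y -> h u \in (q @: Z)%VS) ->
    (dim_quot Y (Y :&: limg j)%VS <= r)%N ->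
    (dim_quot (limg j) (Y :&: limg j)%VS <= n)%N ->
  (rk h <= r + n)%N.
Proof.
move=> /eqP inj_j ZY Zj hX Yr jn; pose X := (j @^-1: Y)%VS.
have dim_j W : \dim (j @: W) = \dim W by rewrite limg_dim_eq // inj_j capv0.
have dimX : \dim X = \dim (Y :&: limg j)%VS.
  by rewrite -(dim_j X) /X -lpreim_cap_limg lpreimK ?capvSr.
have hXZ : (h @: X <= q @: Z)%VS.
  by apply/subvP=> _ /memv_imgP[u Xu ->]; rewrite hX ?memv_preim.
have ZYj : (Z :&: (Y :&: limg j) = 0)%VS by rewrite capvA (capv_idPl ZY).
have dimY : (\dim Z + \dim (Y :&: limg j) <= \dim Y)%N.
  by rewrite -(dimv_disjoint_sum ZYj) dimvS // subv_add ZY capvSl.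
have := limg_ker_dim h fullv; rewrite capfv /rk.
have := limg_ker_dim h X; have := dimvS (capvSr X (lker h)).
have := dimvS hXZ; have := limg_ker_dim q Z.
have := dim_quot_cap (capvSl Y (limg j)).
have := dim_quot_cap (capvSr Y (limg j)); have := dim_j fullv; lia.
Qed.

Section Graph.

Variables (k : fieldType) (E : splittingFieldType k) (V W : vectType k).
Implicit Types T : 'Hom(tensor E V, tensor E W).

Let p1 := extend_hom E (fst_hom V W).
Let p2 := extend_hom E (snd_hom V W).
Let i1 := extend_hom E (inl_hom V W).
Let i2 := extend_hom E (inr_hom V W).

Definition graph_hom T : 'Hom(tensor E V, tensor E (V * W)%type) :=
  i1 + (i2 \o T)%VF.

Lemma graph_homE T u : graph_hom T u = i1 u + i2 (T u).
Proof. by rewrite add_lfunE comp_lfunE. Qed.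

Lemma fst_graph_hom T u : p1 (graph_hom T u) = u.
Proof.
rewrite graph_homE linearD /= -!extend_hom_comp.
rewrite (@eq_extend_hom _ _ _ _ _ \1%VF) => [|v].
  rewrite (@eq_extend_hom _ _ _ _ (_ \o inr_hom _ _) 0) => [|w].
    by rewrite extend_hom1 extend_hom0 addr0.
  by rewrite comp_lfunE inr_homE fst_homE zero_lfunE.
by rewrite comp_lfunE inl_homE fst_homE id_lfunE.
Qed.

Lemma snd_graph_hom T u : p2 (graph_hom T u) = T u.
Proof.
rewrite graph_homE linearD /= -!extend_hom_comp.
rewrite (@eq_extend_hom _ _ _ _ (_ \o inr_hom _ _) \1%VF) => [|w].
  rewrite (@eq_extend_hom _ _ _ _ _ 0) => [|v].
    by rewrite extend_hom1 extend_hom0 add0r.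
  by rewrite comp_lfunE inl_homE snd_homE zero_lfunE.
by rewrite comp_lfunE inr_homE snd_homE id_lfunE.
Qed.

Lemma graph_hom_inj T : lker (graph_hom T) == 0%VS.
Proof. by apply/lker0P; apply: can_inj (fst_graph_hom T). Qed.

(** The inclusions [i1] and [i2] are defined over [k], hence commute with [s]. *)
Lemma gal_act_graph_hom s T u :
  gal_act s (graph_hom T u) = graph_hom (gal_hom s T) (gal_act s u).
Proof.
by rewrite !graph_homE gal_actD !gal_act_extend_hom gal_homE gal_actK.
Qed.

Lemma dim_graph T (X : {vspace tensor E V}) : \dim (graph_hom T @: X) = \dim X.
Proof. by rewrite limg_dim_eq // (eqP (graph_hom_inj T)) capv0. Qed.

(** Where [s(T)] and [T] agree, their graphs share a point, and the graph of [s(T)] is [sA]; so the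
    kernel of [s(T) - T] embeds in the intersection of [A] and [sA]. *)
Lemma dim_quot_graph T (s : gal_of {:E}) (A := limg (graph_hom T)) :
  (dim_quot A (A :&: gal_vs s A)%VS <= rk (gal_hom s T - T)%R)%N.
Proof.
have kerA : (graph_hom T @: lker (gal_hom s T - T) <= A :&: gal_vs s A)%VS.
  apply/subvP=> _ /memv_imgP[u /eqlfunP Tu ->].
  rewrite memv_cap memv_img ?memvf //=; apply/mem_gal_vs.
  exists (graph_hom T (gal_act s^-1%g u)); first by rewrite memv_img ?memvf.
  by rewrite gal_act_graph_hom gal_actVK !graph_homE Tu.
have := dimvS kerA; have := dim_quot_cap (capvSl A (gal_vs s A)).
have := limg_ker_dim (gal_hom s T - T) fullv.
rewrite capfv /rk [in \dim A]/A !dim_graph => {}kerA dimA le_cap.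
by rewrite -(leq_add2l (\dim (A :&: gal_vs s A)%VS)) dimA -kerA leq_add2r.
Qed.

(* [f^-1] is only a right inverse of [f] on its image, so [S] is a section of
   the projection of [W0] to [V] there, with all its values in [W0]. *)
Lemma close_to_extended_hom T (r n : nat) (W0 : {vspace (V * W)%type})
    (A := limg (graph_hom T)) (Y := extend_vs E W0) :
    (dim_quot Y (Y :&: A)%VS <= r)%N -> (dim_quot A (Y :&: A)%VS <= n)%N ->
  exists T0 : 'Hom(V, W), (rk (T - extend_hom E T0)%R <= r + n)%N.
Proof.
(* Composing with [projv W0] encodes the restriction of the first projection to [W0] as a map on the
   whole space. *)
move=> Yr An; pose f := (fst_hom V W \o projv W0)%VF.
pose S : 'Hom(V, (V * W)%type) := (projv W0 \o f^-1)%VF.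
have SW0 v : S v \in W0 by rewrite comp_lfunE memv_proj.
have Sfst : {in W0, (fst_hom V W \o (S \o fst_hom V W))%VF =1 fst_hom V W}.
  move=> w Ww; have fw : fst_hom V W w = f w by rewrite comp_lfunE projv_id.
  rewrite !comp_lfunE fw -[fst_hom V W _](comp_lfunE _ (projv W0)).
  by rewrite limg_lfunVK ?memv_img ?memvf.
have eSY u : extend_hom E S u \in Y.
  rewrite (tensor_decomp u) linear_sum; apply: memv_suml => i _ /=.
  by rewrite extend_homE mem_extend_vs.
pose T0 := (snd_hom V W \o S)%VF; exists T0.
apply: (rk_le_graph_close (q := p2) (Z := (Y :&: lker p1)%VS)
  (graph_hom_inj T) _ _ _ Yr An).
- exact: capvSl.
- apply/eqP; rewrite -subv0; apply/subvP=> w; rewrite !memv_cap memv_ker memv0.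
  case/andP=> /andP[_ /eqP p1w] /memv_imgP[u _ Dw].
  by move: p1w; rewrite Dw fst_graph_hom => ->; rewrite linear0.
- move=> u Xu; apply/memv_imgP.
  (* Written with [p1] implicit, this is [(u, T u) - S u]: both terms lie in [Y] and have first
     component [u], and the second component of the difference is [(T - T0) u]. *)
  exists (graph_hom T u - extend_hom E S u).
    rewrite memv_cap memvB //= memv_ker linearB /= fst_graph_hom subr_eq0.
    rewrite -{1}(fst_graph_hom T u) -(eq_in_extend_hom Sfst Xu).
    by rewrite !extend_hom_comp fst_graph_hom.
  by rewrite linearB /= snd_graph_hom /T0 add_lfunE opp_lfunE -extend_hom_comp.
Qed.

End Graph.

Theorem theoremB (k : fieldType) (E : splittingFieldType k)
    (galE : galois 1%VS {:E}%VS) (V0 : vectType k) :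
  (forall (A : {vspace tensor E V0}) (r : nat),
     (forall s : gal_of {:E}%VS, s \in 'Gal({:E}%VS / 1%VS)%g ->
        (dim_quot A (A :&: gal_vs s A)%VS <= r)%N) ->
     exists W0 : {vspace V0},
       let W : {vspace tensor E V0} := extend_vs E W0 in
       (dim_quot W (W :&: A)%VS <= r)%N /\
       (dim_quot A (W :&: A)%VS <= r * (r + 1) ^ (r + 1))%N)
  /\
  (forall (V0' : vectType k) (T : 'Hom(tensor E V0, tensor E V0')) (r : nat),
     (forall s : gal_of {:E}%VS, s \in 'Gal({:E}%VS / 1%VS)%g ->
        (rk (gal_hom s T - T)%R <= r)%N) ->
     exists T0 : 'Hom(V0, V0'),
       (rk (T - extend_hom E T0)%R <= 2 * r + r * (r + 1) ^ (r + 1))%N).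
Proof.
split=> [A r Ar | V0' T r Tr].
  by apply: almost_invariant_descent => // s; apply: Ar; exact: in_gal1.
have [s|W0 [W0r W0A]] :=
    @almost_invariant_descent _ _ galE _ (limg (graph_hom T)) r.
  by rewrite (leq_trans (dim_quot_graph T s)) // Tr // in_gal1.
(* This gives [r + r (r + 1)^(r + 1)], which is within the stated bound. *)
have [T0 rkT] := close_to_extended_hom W0r W0A.
by exists T0; lia.
Qed.
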